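(* The family $\mathcal{T}^+=\{A\in\mathcal{L}: A\subset\Phi^+(A)\}$ is a strong generalized topology on $\mathbb{R}$, and $\mathcal{T}_d\subset\mathcal{T}^+\subset\mathcal{L}$.
   Context: $\mathcal{L}$ is the family of Lebesgue measurable subsets of $\mathbb{R}$, $\lambda$ is Lebesgue measure. For $A\in\mathcal{L}$ and $x\in\mathbb{R}$ put $\bar D(A,x)=\limsup_{h\to0^+}\frac{\lambda(A\cap[x-h,x+h])}{2h}$ and $D(A,x)=\lim_{h\to0^+}\frac{\lambda(A\cap[x-h,x+h])}{2h}$ (when the limit exists). Define $\Phi^+(A)=\{x\in\mathbb{R}:\bar D(A,x)>0\}$ and $\Phi_d(A)=\{x\in\mathbb{R}: D(A,x)=1\}$. The density topology is $\mathcal{T}_d=\{A\in\mathcal{L}:A\subset\Phi_d(A)\}$. A generalized topology on a nonempty set $X$ is a family $\gamma$ of subsets of $X$ with $\emptyset\in\gamma$ and $\bigcup_{t\in T}G_t\in\gamma$ whenever $\{G_t:t\in T\}\subset\gamma$; it is strong if moreover $X\in\gamma$. *)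

(* Defs.v *)
From mathcomp Require Import all_boot all_order all_algebra.
From mathcomp Require Import all_classical all_reals all_analysis.
Set Implicit Arguments.
Unset Strict Implicit.
Unset Printing Implicit Defensive.
Import Order.TTheory GRing.Theory Num.Theory.
Import numFieldNormedType.Exports.
Local Open Scope classical_set_scope.
Local Open Scope ring_scope.

(* A family {G_t : t in T} is given by the set F of its members. *)
Definition generalized_topology (X : Type) (gamma : set (set X)) : Prop :=
  [/\ [set: X] !=set0, gamma set0 &
      forall F : set (set X), F `<=` gamma -> gamma (\bigcup_(G in F) G)].

Definition strong_generalized_topology (X : Type) (gamma : set (set X)) : Prop :=
  generalized_topology gamma /\ gamma [set: X].

Section density.
Context {R : realType}.
Implicit Types (A : set R) (x h : R).
Local Open Scope ereal_scope.

(* [measurable] at type [set R] denotes the Borel sets.  The Lebesgue sets are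
   the Caratheodory-measurable sets of Lebesgue outer measure, i.e. the
   domain of [completed_lebesgue_measure]. *)
Definition lebesgue_sets : set (set R) :=
  (@wlength R idfun)^*%mu.-cara.-measurable.

Definition density_ratio A x h : \bar R :=
  completed_lebesgue_measure (A `&` `[(x - h)%R, (x + h)%R]) / (2 * h)%:E.

Definition upper_density A x : \bar R := limf_esup (density_ratio A x) 0^'+.

Definition Phi_plus A : set R := [set x | 0 < upper_density A x].

(* The convergence statement includes the existence of the limit. *)
Definition Phi_d A : set R := [set x | density_ratio A x h @[h --> 0^'+] --> 1].

Definition density_topology : set (set R) :=
  [set A | lebesgue_sets A /\ A `<=` Phi_d A].

Definition T_plus : set (set R) :=
  [set A | lebesgue_sets A /\ A `<=` Phi_plus A].

End density.

(* Main.v *)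
(* Let U be a union of members of T^+ and B a Borel measurable hull of ~` U.
   Each member A is disjoint from ~` U, so A meets B in a null set; hence at a
   point of A the upper density of ~` B is at least that of A, so positive.  By
   the Lebesgue density theorem almost no point of B has this property, so U
   meets B in a null set and ~` U = B `\` (U `&` B) is Lebesgue measurable. *)

Require Import Defs.
From mathcomp Require Import all_boot all_order all_algebra.
From mathcomp Require Import all_classical all_reals all_analysis.
From mathcomp Require Import measurable_realfun.
Import Order.TTheory GRing.Theory Num.Theory.
Import numFieldNormedType.Exports.
Local Open Scope classical_set_scope.
Local Open Scope ring_scope.
Local Open Scope ereal_scope.

Section limf_esup.
Context {T : choiceType} {X : filteredType T} {R : realType}.
Implicit Types (f g : X -> \bar R) (F : set_system X) (c : \bar R).

Lemma limf_esup_le_near f F {FF : Filter F} c :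
  (\forall x \near F, f x <= c) -> limf_esup f F <= c.
Proof.
move=> fc; rewrite limf_esupE; apply: ge_ereal_inf.
exists (ereal_sup (f @` [set x | f x <= c])).
  by exists [set x | f x <= c].
by apply: ge_ereal_sup => _ [x fxc <-].
Qed.

Lemma limf_esup_ge_near f F {FF : ProperFilter F} c :
  (\forall x \near F, c <= f x) -> c <= limf_esup f F.
Proof.
move=> cf; rewrite limf_esupE; apply: le_ereal_inf_tmp => _ [V FV <-].
have [x [Vx cfx]] := filter_ex (filterI FV cf).
by apply: (le_trans cfx); apply: ereal_sup_ubound; exists x.
Qed.

Lemma le_limf_esup f g F {FF : Filter F} :
  (\forall x \near F, f x <= g x) -> limf_esup f F <= limf_esup g F.
Proof.
move=> fg; rewrite !limf_esupE; apply: le_ereal_inf_tmp => _ [V FV <-].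
(* Shrinking [V] to the points where [f x <= g x] stays in the filter, and there the supremum of [f]
   is bounded by that of [g] over [V]. *)
apply: ge_ereal_inf; exists (ereal_sup (f @` (V `&` [set x | f x <= g x]))).
  by exists (V `&` [set x | f x <= g x]) => //; exact: filterI.
apply: ge_ereal_sup => _ [x [Vx fgx] <-].
by apply: (le_trans fgx); apply: ereal_sup_ubound; exists x.
Qed.

End limf_esup.

Section density.
Context {R : realType}.
Implicit Types (A B : set R) (x h : R).
Local Notation mu := (@lebesgue_measure R).
Local Notation mu_star := ((@wlength R idfun)^*%mu).

(** The completed measure is, by conversion, the outer measure [mu_star], so monotonicity and
    subadditivity apply to arbitrary sets. *)
Lemma density_ratioE A x h :
  density_ratio A x h = mu_star (A `&` `[(x - h)%R, (x + h)%R]) / (2 * h)%:E.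
Proof. by []. Qed.

Lemma le_density_ratio A B x h : (0 < h)%R ->
  mu_star (A `&` `[(x - h)%R, (x + h)%R]) <=
    mu_star (B `&` `[(x - h)%R, (x + h)%R]) ->
  density_ratio A x h <= density_ratio B x h.
Proof.
move=> h0 AB; rewrite !density_ratioE; apply: lee_wpmul2r => //.
by rewrite inve_ge0 lee_fin mulr_ge0// ltW.
Qed.

(** The closed interval adds only two endpoints, a null set, to the open ball; the ball form is the
    one used by [lebesgue_density]. *)
Lemma density_ratio_ball A x h : measurable A -> (0 < h)%R ->
  density_ratio A x h = mu (A `&` ball x h) * (mu (ball x h))^-1.
Proof.
move=> mA h0; rewrite lebesgue_measure_ball ?ltW// -mulr_natl density_ratioE.
congr (_ * _).
have -> : A `&` `[(x - h)%R, (x + h)%R] =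
    (A `&` ball x h) `|` (A `&` [set (x - h)%R; (x + h)%R]).
  rewrite -setIUr; congr (_ `&` _).
  by rewrite -closed_ball_itv// closed_ball_ball// setUAC setUC.
apply: (@measureU0 _ _ _ mu).
- by apply: measurableI => //; exact: measurable_ball.
- by apply: measurableI => //; exact: measurableU.
- apply/eqP; rewrite -measure_le0.
  rewrite (@le_trans _ _ (mu [set (x - h)%R; (x + h)%R]))//.
    by apply: le_outer_measure; exact: subIsetr.
  by rewrite countable_lebesgue_measure0//; exact/finite_set_countable.
Qed.

Lemma ae_density_ratio_cvg A : measurable A ->
  {ae mu, forall x, density_ratio A x h @[h --> 0^'+] --> (\1_A x)%:E}.
Proof.
move=> mA; apply: negligibleS (lebesgue_density mA).
apply: subsetC => x /=; apply: cvg_trans.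
by apply: near_eq_cvg; near=> h; rewrite density_ratio_ball.
Unshelve. all: by end_near. Qed.

Lemma upper_density_le0 A x :
  density_ratio A x h @[h --> 0^'+] --> 0 -> upper_density A x <= 0.
Proof.
move=> A0; apply/lee_addgt0Pr => e e0; rewrite add0e.
apply: limf_esup_le_near.
near=> h; apply: ltW; near: h; apply: (A0 [set y | y < e%:E]).
apply: open_nbhs_nbhs; split; first exact: open_ereal_lt_ereal.
by rewrite /= lte_fin.
Unshelve. all: by end_near. Qed.

Lemma Phi_d_sub_Phi_plus A : Phi_d A `<=` Phi_plus A.
Proof.
(* Any constant strictly between 0 and 1 would do: the ratio tends to 1, so it eventually exceeds
   it. *)
move=> x A1; apply: (@lt_le_trans _ _ (2^-1)%:E).
  by rewrite lte_fin invr_gt0.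
apply: limf_esup_ge_near.
near=> h; apply: ltW; near: h; apply: (A1 [set y | (2^-1)%:E < y]).
apply: open_nbhs_nbhs; split; first exact: open_ereal_gt_ereal.
by rewrite /= lte_fin invf_lt1// ltr1n.
Unshelve. all: by end_near. Qed.

Lemma Phi_plus_mono A B : A `<=` B -> Phi_plus A `<=` Phi_plus B.
Proof.
move=> AB x; move/lt_le_trans; apply; apply: le_limf_esup; near=> h.
by apply: le_density_ratio => //; apply: le_outer_measure; exact: setSI.
Unshelve. all: by end_near. Qed.

Lemma Phi_dT : Phi_d [set: R] = [set: R].
Proof.
rewrite -subTset => x _ /=.
apply: cvg_near_cst; near=> h.
rewrite density_ratio_ball// setTI lebesgue_measure_ball//.
(* The extended inverse is defined by cases on a zero denominator; [0 < h] excludes that case. *)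
rewrite inver mulrn_eq0/= gt_eqF//.
by rewrite -EFinM mulfV// mulrn_eq0/= gt_eqF.
Unshelve. all: by end_near. Qed.

Lemma borel_lebesgue_sets A : measurable A -> lebesgue_sets A.
Proof. exact: sub_caratheodory. Qed.

Lemma null_lebesgue_sets A : mu_star A = 0 -> lebesgue_sets A.
Proof.
move=> /negligible_outer_measure[B [mB B0 AB]].
apply: completed_lebesgue_measure_is_complete.
by exists B; split => //; exact: borel_lebesgue_sets.
Qed.

(** Take for [B] a G-delta set containing [A] with the same outer measure. If [C] misses [A], then
    [B] minus [C] still contains [A], hence has the full measure of [B]; the Caratheodory splitting
    of [B] along [C] leaves 0 for [C]&[B], finiteness allowing the cancellation. *)
Lemma lebesgue_hull_fin A : mu_star A < +oo ->
  exists B, [/\ measurable B, A `<=` B & forall C, lebesgue_sets C ->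
    C `&` A = set0 -> mu_star (C `&` B) = 0].
Proof.
move=> Afin; have [G [oG AG Gmu]] := outer_measure_Gdelta A.
exists (\bigcap_i G i); split => //.
  by apply: bigcapT_measurable => i; exact: open_measurable.
move=> C mC CA; set B := \bigcap_i G i.
have BC : mu_star A <= mu_star (B `&` ~` C).
  apply: le_outer_measure => x Ax; split; first exact: AG.
  by move=> Cx; suff : set0 x by []; rewrite -CA.
have qfin : mu_star (B `&` ~` C) \is a fin_num.
  rewrite ge0_fin_numE ?outer_measure_ge0//.
  by apply: le_lt_trans Afin; rewrite -Gmu; apply: le_outer_measure.
apply/eqP; rewrite eq_le outer_measure_ge0 andbT setIC -(leeD2rE _ _ qfin).
by rewrite add0e -mC [leLHS]Gmu.
Qed.

(** Hulls of the bounded pieces of [A] are glued by a countable union. Minimality of the hull is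
    expressed through null intersections because equality of measures says too little when they are
    infinite. *)
Lemma lebesgue_hull A :
  exists B, [/\ measurable B, A `<=` B & forall C, lebesgue_sets C ->
    C `&` A = set0 -> mu_star (C `&` B) = 0].
Proof.
have An n : mu_star (A `&` ball 0%R n%:R) < +oo.
  apply: (@le_lt_trans _ _ (mu (ball 0%R n%:R))).
    by apply: le_outer_measure; exact: subIsetr.
  by rewrite lebesgue_measure_ball ?ltry.
have [B /all_and3[mB AB CB]] := choice (fun n => lebesgue_hull_fin _ (An n)).
exists (\bigcup_n B n); split.
- exact: bigcupT_measurable.
(* The successor makes the radius strictly larger than [|x|], as the open ball requires. *)
- move=> x Ax; exists (Num.trunc `|x|).+1 => //; apply: AB; split => //.
  by rewrite /ball/= sub0r normrN truncnS_gt.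
- move=> C mC CA; rewrite setI_bigcupr.
  apply/negligible_outer_measure/negligible_bigcup => n.
  by apply/negligible_outer_measure/CB => //; rewrite setIA CA set0I.
Qed.

Lemma lebesgue_sets_bigcup_T_plus (F : set (set R)) : F `<=` T_plus ->
  lebesgue_sets (\bigcup_(G in F) G).
Proof.
move=> FT; set U := \bigcup_(G in F) G.
have [B [mB UB CB]] := lebesgue_hull (~` U).
have UB0 : mu_star (U `&` B) = 0.
  apply/negligible_outer_measure.
  have := ae_density_ratio_cvg _ (measurableC mB).
  apply: negligibleS => x [[A FA Ax] Bx] /=.
  rewrite indicE memNset /=; last by move=> /(_ Bx).
  move=> /upper_density_le0; apply/negP; rewrite -ltNge.
  have [mA /(_ _ Ax) Ax0] := FT _ FA.
  apply: (lt_le_trans Ax0); apply: le_limf_esup; near=> h.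
  apply: le_density_ratio => //.
  (* The added 0 is read as the measure of [A]&[B], so that subadditivity over the parts of [A]
     inside and outside [B] concludes. *)
  rewrite -[leRHS]add0e.
  have <- : mu_star (A `&` B) = 0.
    apply: CB => //; rewrite -subset0 => y [Ay]; apply; by exists A.
  apply: (le_trans _ (outer_measureU2 _ _ _)); apply: le_outer_measure.
  move=> y [Ay yh]; have [By|nBy] := pselect (B y); [left|right] => //.
rewrite -[U]setCK (_ : ~` U = B `\` (U `&` B)).
  by apply/measurableC/measurableD; [exact: borel_lebesgue_sets
                                    |exact: null_lebesgue_sets].
by rewrite setDIr setDv setU0 setDE; apply/esym/setIidr.
Unshelve. all: by end_near. Qed.

End density.

Local Close Scope ereal_scope.
Local Close Scope ring_scope.

Theorem theorem2 (R : realType) :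
  strong_generalized_topology (@T_plus R) /\
  (@density_topology R `<=` @T_plus R /\ @T_plus R `<=` @lebesgue_sets R).
Proof.
split; [split; [split|]|split].
- by exists point.
- by split; [exact: measurable0|].
- move=> F FT; split; first exact: lebesgue_sets_bigcup_T_plus.
  move=> x [A FA Ax]; have [_ /(_ x Ax)] := FT A FA.
  by apply: Phi_plus_mono; exact: bigcup_sup.
- split; first exact: measurableT.
  by move=> x _; apply: Phi_d_sub_Phi_plus; rewrite Phi_dT.
- move=> A [mA Ad]; split => //.
  exact: subset_trans (@Phi_d_sub_Phi_plus R A).
- by move=> A [].
Qed.
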